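(* Let $h \ge p \ge 1$ be integers, and let $T$ be a finite tree with diameter at least $3$ or an infinite tree with finite maximum degree. Let $\Delta$ be the maximum degree of $T$. (a) If $T$ contains $T_{\Delta-1,2}$ as a subtree, then $$h + (2\Delta-3)p \le \lambda_{h,p,p}(T) \le \lambda^*_{h,p,p}(T) \le h + 2(\Delta-1)p.$$ (b) If $T$ contains $\hat{T}_{\Delta-1,2}$ as a subtree, then $$\lambda_{h,p,p}(T) = \lambda^*_{h,p,p}(T) = h + 2(\Delta-1)p.$$
   Context: Graphs are undirected; an infinite graph means one with countably infinitely many vertices. $N(u)$ is the neighbourhood of $u$ and $d(u,v)$ the distance between $u$ and $v$. An $L(h_1,h_2,h_3)$-labelling of a graph $G$ with span $\ell$ ($\ell$ a positive integer) is a mapping $f: V(G)\to\{0,1,\ldots,\ell\}$ such that for $i=1,2,3$ and any $u,v\in V(G)$ with $d(u,v)=i$ we have $|f(u)-f(v)|\ge h_i$. $\lambda_{h_1,h_2,h_3}(G)$ is the minimum span of such a labelling. An interval modulo $n$ is a set of the form $\{a \bmod n, (a+1) \bmod n, \ldots, b \bmod n\}$ (going cyclically from $a$ to $b$). An $L(h_1,h_2,h_3)$-labelling $f$ with span $\ell$ is elegant if for every vertex $u$ there is an interval $I_u$ modulo $\ell+1$ such that $f(N(u))\subseteq I_u$, and for every edge $uv$, $I_u\cap I_v=\emptyset$. $\lambda^*_{h_1,h_2,h_3}(G)$ is the minimum $\ell$ such that $G$ admits an elegant $L(h_1,h_2,h_3)$-labelling with span $\ell$ ($\infty$ if none exists).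 For integers $m,k\ge 2$: $T_{m,k}$ is the complete $m$-ary tree of height $k$, i.e. the rooted tree in which every non-leaf vertex has exactly $m$ children and all leaves are at level (distance from the root) $k$; $\hat{T}_{m,k}$ is the finite subtree of the infinite $(m+1)$-regular tree induced by all vertices at distance at most $k$ from a fixed vertex. Since $m\ge2$ is assumed for these trees, the hypotheses of (a) and (b) presuppose $\Delta\ge 3$. *)

(* Defs.v *)
From mathcomp Require Import all_boot all_order all_algebra.

Set Implicit Arguments.
Unset Strict Implicit.
Unset Printing Implicit Defensive.

(* A countType carrier covers exactly the finite and the countably infinite
   vertex sets. *)
Record sgraph := SGraph {
  vertex :> countType;
  adj : rel vertex;
  adj_sym : symmetric adj;
  adj_irr : irreflexive adj
}.

Arguments adj {s} _ _.

Definition has_card (V : eqType) (P : V -> Prop) (n : nat) : Prop :=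
  exists s : seq V, [/\ uniq s, size s = n & forall x, x \in s <-> P x].

Definition finite_graph (G : sgraph) : Prop :=
  exists n, has_card (fun _ : G => True) n.

Definition infinite_graph (G : sgraph) : Prop := ~ finite_graph G.

Definition walk (G : sgraph) (u v : G) (n : nat) : Prop :=
  exists p : seq G, [/\ path adj u p, last u p = v & size p = n].

(* d(u,v) = n, as a relation: no n is related to u, v in distinct components. *)
Definition dist (G : sgraph) (u v : G) (n : nat) : Prop :=
  walk u v n /\ forall k, walk u v k -> n <= k.

Definition connected (G : sgraph) : Prop :=
  forall u v : G, exists n, walk u v n.

Definition acyclic (G : sgraph) : Prop :=
  forall c : seq G, 3 <= size c -> ~ ucycle adj c.

Definition is_tree (G : sgraph) : Prop :=
  [/\ inhabited G, connected G & acyclic G].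

Definition diameter (G : sgraph) (d : nat) : Prop :=
  (exists u v : G, dist u v d) /\
  (forall (u v : G) n, dist u v n -> n <= d).

Definition degree (G : sgraph) (u : G) (d : nat) : Prop :=
  has_card (fun v => adj u v) d.

Definition max_degree (G : sgraph) (D : nat) : Prop :=
  (exists u : G, degree u D) /\
  (forall u : G, exists2 d, degree u d & d <= D).

Definition regular_tree (R : sgraph) (d : nat) : Prop :=
  is_tree R /\ forall u : R, degree u d.

Definition child (G : sgraph) (o u v : G) : Prop :=
  adj u v /\ exists i, dist o u i /\ dist o v i.+1.

Definition leaf (G : sgraph) (o u : G) : Prop :=
  forall v, ~ child o u v.

(* The bound on the levels is the height: without it, the infinite leafless
   m-ary tree would satisfy the other clauses. *)
Definition complete_mary_tree (m k : nat) (H : sgraph) (o : H) : Prop :=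
  [/\ is_tree H,
      forall u i, dist o u i -> i <= k,
      forall u, ~ leaf o u -> has_card (child o u) m
    & forall u, leaf o u -> dist o u k].

(* The subgraph of H induced by P is isomorphic to a subgraph of G. *)
Definition contains_induced (G H : sgraph) (P : H -> Prop) : Prop :=
  exists g : H -> G,
    (forall x y, P x -> P y -> g x = g y -> x = y) /\
    (forall x y, P x -> P y -> adj x y -> adj (g x) (g y)).

(* T_{m,k} and the infinite (m+1)-regular tree are determined up to
   isomorphism by their defining properties, so in the next two definitions it
   is immaterial which copy is chosen. *)
Definition contains_T (G : sgraph) (m k : nat) : Prop :=
  exists (H : sgraph) (o : H),
    complete_mary_tree m k o /\ contains_induced G (fun _ : H => True).

Definition contains_That (G : sgraph) (m k : nat) : Prop :=
  exists (R : sgraph) (o : R),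
    regular_tree R m.+1 /\
    contains_induced G (fun x : R => exists2 i, dist o x i & i <= k).

Definition L_labelling (G : sgraph) (h1 h2 h3 l : nat) (f : G -> 'I_l.+1)
    : Prop :=
  [/\ 0 < l,
      forall u v : G, dist u v 1 -> h1 <= `|f u - f v|,
      forall u v : G, dist u v 2 -> h2 <= `|f u - f v|
    & forall u v : G, dist u v 3 -> h3 <= `|f u - f v| ].

Definition interval_mod (n : nat) (I : {set 'I_n}) : Prop :=
  exists a b : nat, a <= b /\
    forall x : 'I_n, x \in I <-> exists2 c, a <= c <= b & x = c %% n :> nat.

Definition elegant (G : sgraph) (l : nat) (f : G -> 'I_l.+1) : Prop :=
  exists I : G -> {set 'I_l.+1},
    [/\ forall u, interval_mod (I u),
        forall u v, adj u v -> f v \in I u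
      & forall u v, adj u v -> [disjoint I u & I v]].

Definition is_min (P : nat -> Prop) (l : nat) : Prop :=
  P l /\ forall l', P l' -> l <= l'.

(* lambda G h1 h2 h3 l and lambda_star G h1 h2 h3 l say that the invariant is
   finite and equal to l. *)
Definition lambda (G : sgraph) (h1 h2 h3 l : nat) : Prop :=
  is_min (fun l => exists f : G -> 'I_l.+1, L_labelling h1 h2 h3 f) l.

Definition lambda_star (G : sgraph) (h1 h2 h3 l : nat) : Prop :=
  is_min (fun l => exists f : G -> 'I_l.+1,
    L_labelling h1 h2 h3 f /\ elegant f) l.

(* Main.v *)
Require Import Defs.
From mathcomp Require Import all_boot all_order all_algebra.
From mathcomp Require Import zify.
From Stdlib Require Import Classical ClassicalEpsilon.

Set Implicit Arguments.
Unset Strict Implicit.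
Unset Printing Implicit Defensive.

(** Upper bound: a tree is bipartite, and its vertices can be coloured with D
colours so that each neighbourhood is rainbow ([tree_colouring]).  Give the
even class the labels 0, p, ..., (D-1)p and the odd class the same labels
shifted by (D-1)p + h, according to colour.  Vertices at distance 1 or 3 lie in
opposite classes, whose labels are at least h apart; vertices at distance 2 lie
in the same class and have different colours.  The labelling is elegant because
the two classes use two disjoint blocks of labels ([elegant_labelling]).

Lower bound ([span_lower_bound]): for an edge uv of an acyclic graph, the
neighbours of u together with those of v are pairwise at distance at most 3, so
their labels are p-separated.  A gap of length h among them is forced by a
good choice of v, namely the neighbour of u whose label is closest to that of
u.  Every neighbour of v has a label at distance at least h from f v, and by
the choice of v so does every neighbour of u whose label lies on the same side
of f v as f u.  Hence a + b labels of which two consecutive ones differ by h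
instead of p need a span of at least h + (a + b - 2)p.  At the root of T_{D-1,2}
this applies with a = D - 1 and b = D, at the centre of a ball of radius 2 in
the D-regular tree with a = b = D. *)

(** * Simple paths and distances in acyclic graphs *)

(** Shortening the walk r to a simple path would close a cycle through u.  All
uses of acyclicity below go through this form, which spares the explicit
construction of cycles. *)
Lemma no_detour (G : sgraph) (u a b : G) (r : seq G) :
  acyclic G -> adj u a -> adj u b -> path adj a r -> last a r = b ->
  u \notin a :: r -> a = b.
Proof.
move=> acG ua ub pr lr ur.
case: (shortenP pr) lr => -[|c r'] pr' ur' sub /= lr //.
have ur2 : u \notin [:: a, c & r'].
  apply: contra ur; rewrite !inE => /orP[->//|] H.
  by apply/orP; right; apply: sub; rewrite inE.
case: (acG [:: u, a, c & r']) => //.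
rewrite /ucycle; apply/andP; split; last by rewrite cons_uniq ur2.
rewrite (cycle_path u) /= lr adj_sym ub ua /=; exact: pr'.
Qed.

(** Where the two paths diverge after x, the rest of p followed by the rest of q
backwards is a walk between two neighbours of x that avoids x. *)
Lemma simple_path_unique (G : sgraph) (x : G) (p q : seq G) :
  acyclic G -> path adj x p -> path adj x q -> uniq (x :: p) ->
  uniq (x :: q) -> last x p = last x q -> p = q.
Proof.
move=> acG; elim: p x q => [|a p IH] x [|b q] //=.
- by move=> _ _ _ /andP[xq _] E; case/negP: xq; rewrite {1}E mem_last.
- by move=> _ _ /andP[xq _] _ E; case/negP: xq; rewrite -{1}E mem_last.
move=> /andP[xa pa] /andP[xb pb] /andP[xp up] /andP[xq uq] E.
(* If a = b, the paths have a common first step and the induction continues. *)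
suff ab : a = b by subst b; rewrite (IH a q).
apply: (@no_detour _ x a b (p ++ rev (belast b q))) => //.
- rewrite cat_path pa E rev_path.
  by under eq_path do rewrite adj_sym.
- rewrite last_cat E; case: q {IH xb pb xq uq} E => [|c q] E //=.
  by rewrite rev_cons last_rcons.
- rewrite -cat_cons mem_cat negb_or xp mem_rev.
  by apply: contra xq; apply: mem_belast.
Qed.

Lemma adj_neq (G : sgraph) (u v : G) : adj u v -> u <> v.
Proof. by move=> uv E; rewrite E adj_irr in uv. Qed.

Lemma walk0E (G : sgraph) (u v : G) : walk u v 0 -> u = v.
Proof. by case=> -[|w r] [_ //= <-]. Qed.

Lemma walk1E (G : sgraph) (u v : G) : walk u v 1 -> adj u v.
Proof. by case=> -[|w [|z r]] [//= + <- //]; rewrite andbT. Qed.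

Lemma walk2E (G : sgraph) (u v : G) :
  walk u v 2 -> exists2 w, adj u w & adj w v.
Proof.
by case=> -[|w [|z [|t r]]] [//= /and3P[uw wz _] <- _]; exists w.
Qed.

Lemma dist0 (G : sgraph) (u : G) : dist u u 0.
Proof. by split=> //; exists [::]. Qed.

Lemma dist_inj (G : sgraph) (u v : G) i j : dist u v i -> dist u v j -> i = j.
Proof.
by case=> wi mi [wj mj]; apply/eqP; rewrite eqn_leq (mi _ wj) (mj _ wi).
Qed.

Lemma dist1P (G : sgraph) (u v : G) : dist u v 1 <-> adj u v.
Proof.
split=> [[/walk1E uv _ //]|uv].
split; first by exists [:: v]; rewrite /= uv.
by case=> [/walk0E /(adj_neq uv)|].
Qed.

Lemma dist2P (G : sgraph) (u v : G) : acyclic G ->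
  dist u v 2 <-> u <> v /\ exists2 w, adj u w & adj w v.
Proof.
move=> acG; split.
  case=> /walk2E[w uw wv] dm; split; last by exists w.
  by move=> E; have /dm : walk u v 0 by exists [::].
case=> nuv [w uw wv]; split; first by exists [:: w; v]; rewrite /= uw wv.
case=> [|[|//]].
  by move/walk0E.
move/walk1E => uv.
case: nuv; apply: (@no_detour _ w u v [:: v]) => //=.
- by rewrite adj_sym.
- by rewrite uv.
rewrite !inE negb_or; apply/andP; split; apply/eqP => E.
  by rewrite E adj_irr in uw.
by rewrite E adj_irr in wv.
Qed.

Lemma dist3_edge (G : sgraph) (u v x y : G) : acyclic G ->
  adj u v -> adj u x -> adj v y -> x <> v -> y <> u -> dist x y 3.
Proof.
move=> acG uv ux vy nxv nyu.
have vu : adj v u by rewrite adj_sym.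
have yv : adj y v by rewrite adj_sym.
have nux : u != x by apply/eqP/adj_neq.
have nuv : u != v by apply/eqP/adj_neq.
have nuy : u != y by apply/eqP => E; apply: nyu.
(* A walk from x to y through r, continued to v, joins two neighbours of u. *)
have det r : path adj x (rcons r y) -> u \notin r -> False.
  move=> pr ur; apply: nxv.
  apply: (@no_detour _ u x v (rcons r y ++ [:: v])) => //.
  - by rewrite cat_path pr last_rcons /= yv.
  - by rewrite last_cat last_rcons.
  by rewrite inE mem_cat mem_rcons !inE (negPf nux) (negPf nuy) (negPf ur).
split; first by exists [:: u; v; y]; rewrite /= adj_sym ux uv vy.
case=> [|[|[|//]]].
- move/walk0E => E; case: nyu; subst y.
  apply: (@no_detour _ v x u [:: u]) => //=; first by rewrite adj_sym ux.
  rewrite !inE negb_or; apply/andP; split; apply/eqP => // E.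
    by apply: nxv.
  by move: vu; rewrite E adj_irr.
- by move/walk1E => xy; case: (det [::]); rewrite /= ?xy.
move/walk2E => [z xz zy]; case: (u =P z) => [E|nuz].
  subst z; case: nyu; apply/esym.
  apply: (@no_detour _ v u y [:: y]) => //=; first by rewrite zy.
  rewrite !inE negb_or; apply/andP; split; apply/eqP => E.
    by move: uv; rewrite E adj_irr.
  by move: vy; rewrite E adj_irr.
by case: (det [:: z]); rewrite /= ?xz ?zy // inE; apply/eqP.
Qed.

(** * The lower bound *)

(** Division by p is injective on p-separated numbers. *)
Lemma packing (V : eqType) (s : seq V) (F : V -> nat) (p l : nat) :
  0 < p -> uniq s ->
  {in s &, forall x y, x <> y -> F x + p <= F y \/ F y + p <= F x} ->
  {in s, forall x, F x <= l} -> (size s).-1 * p <= l.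
Proof.
move=> p0 us sep ub.
have inj : {in s &, injective (fun x => F x %/ p)}.
  move=> x y xs ys E; apply/eqP/negPn/negP => /eqP nxy.
  have Lx := divn_eq (F x) p; have Ly := divn_eq (F y) p.
  have mx := ltn_pmod (F x) p0; have my := ltn_pmod (F y) p0.
  rewrite /= in E; rewrite E in Lx.
  by case: (sep x y xs ys nxy); lia.
have: size [seq F x %/ p | x <- s] <= size (iota 0 (l %/ p).+1).
  apply: uniq_leq_size; first by rewrite map_inj_in_uniq.
  move=> _ /mapP[x xs ->]; rewrite mem_iota /= add0n ltnS.
  exact: leq_div2r (ub x xs).
rewrite size_map size_iota => H.
apply: leq_trans (leq_divM l p); rewrite leq_mul2r; apply/orP; right.
by case: (size s) H.
Qed.

(** Shrinking the gap from length h to length p keeps the values p-separated,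
which reduces the claim to [packing]. *)
Lemma packing_gap (V : eqType) (s : seq V) (F : V -> nat) (h p l t : nat) :
  0 < p -> p <= h -> uniq s ->
  {in s &, forall x y, x <> y -> F x + p <= F y \/ F y + p <= F x} ->
  {in s, forall x, F x <= t \/ t + h <= F x} ->
  t + h <= l -> {in s, forall x, F x <= l} ->
  (size s).-1 * p + (h - p) <= l.
Proof.
move=> p0 ph us sep gap tl ub.
pose F' x := if F x <= t then F x else F x - (h - p).
suff: (size s).-1 * p <= l - (h - p) by lia.
apply: (@packing _ s F') => // [x y xs ys nxy|x xs]; rewrite /F'.
  have := sep x y xs ys nxy; have := gap x xs; have := gap y ys.
  by case: (leqP (F x) t); case: (leqP (F y) t); lia.
have := gap x xs; have := ub x xs; case: (leqP (F x) t); lia.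
Qed.

(** The closest-label choice of the neighbour v of u is what produces a gap of
length h next to f v, on the side of f u. *)
Lemma span_lower_bound (G : sgraph) (h p l a b : nat) (f : G -> 'I_l.+1)
    (u : G) (A : seq G) :
  acyclic G -> 0 < p -> p <= h -> L_labelling h p p f ->
  0 < a -> uniq A -> size A = a -> {in A, forall v, adj u v} ->
  {in A, forall v, exists B : seq G,
     [/\ uniq B, size B = b & {in B, forall w, adj v w}]} ->
  (a + b).-1 * p + (h - p) <= l.
Proof.
move=> acG p0 ph [_ f1 f2 f3] a0 uA sA adjA nbA.
have [v0 v0A] : exists v0, v0 \in A.
  by case: (A) sA => [/= E|v0 A' _]; [rewrite -E in a0 | exists v0; rewrite inE eqxx].
have [v vA vmin] : exists2 v, v \in A &
    {in A, forall w, `|f u - f v| <= `|f u - f w|}.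
  pose P n := has (fun v => `|f u - f v| == n) A.
  have exP : exists n, P n by exists `|f u - f v0|; apply/hasP; exists v0.
  case: (ex_minnP exP) => n /hasP[v vA /eqP <-] nmin; exists v => // w wA.
  by apply: nmin; apply/hasP; exists w.
have uv := adjA v vA.
have [B [uB sB adjB]] := nbA v vA.
have sepAB x y : x \in A -> y \in B -> p <= `|f x - f y|.
  move=> xA yB; have ux := adjA x xA; have vy := adjB y yB.
  case: (x =P v) => [->|nxv].
    by apply: leq_trans ph _; apply: f1; apply/dist1P.
  case: (y =P u) => [->|nyu].
    by apply: leq_trans ph _; apply: f1; apply/dist1P; rewrite adj_sym.
  exact: f3 (dist3_edge acG uv ux vy nxv nyu).
have sep_nb z x y : adj z x -> adj z y -> x <> y -> p <= `|f x - f y|.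
  move=> zx zy nxy; apply: f2; apply/dist2P => //; split=> //.
  by exists z => //; rewrite adj_sym.
have farB y : y \in B -> h <= `|f v - f y|.
  by move=> yB; apply: f1; apply/dist1P; apply: adjB.
have faru : h <= `|f u - f v| by apply: f1; apply/dist1P.
(* A common element of A and B would be at distance 0 < p from itself. *)
have usz : uniq (A ++ B) /\ size (A ++ B) = a + b.
  rewrite size_cat sA sB; split=> //; rewrite cat_uniq uA uB andbT /=.
  apply/hasPn => y yB; apply/negP => yA.
  by have := sepAB y y yA yB; lia.
case: usz => usz <-.
have sep : {in A ++ B &, forall x y, x <> y ->
    f x + p <= f y \/ f y + p <= f x}.
  move=> x y; rewrite !mem_cat => /orP[xA|xB] /orP[yA|yB] nxy.
  - by have := sep_nb u x y (adjA x xA) (adjA y yA) nxy; lia.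
  - by have := sepAB x y xA yB; lia.
  - by have := sepAB y x yA xB; lia.
  - by have := sep_nb v x y (adjB x xB) (adjB y yB) nxy; lia.
have ub w : f w <= l by rewrite -ltnS.
(* The gap of length h sits on the side of f v that faces f u. *)
pose t := if f u < f v then f v - h else f v : nat.
apply: (@packing_gap _ (A ++ B) (fun x => f x : nat) h p l t) => //.
  move=> x; rewrite mem_cat /t => /orP[xA|/farB]; last by case: ltnP; lia.
  by have := vmin x xA; case: ltnP; lia.
by rewrite /t; have := ub u; have := ub v; case: ltnP; lia.
Qed.

(** * An elegant labelling *)

(** A function on a tree may be defined from a root outwards along the edges.
The disjunction hides the orientation of the edge uv: the recursion ran along
it in one of the two directions. *)
Lemma tree_recursion (G : sgraph) (S : Type) (step : G -> G -> S -> S)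
    (s0 : S) : is_tree G ->
  exists F : G -> S, forall u v, adj u v ->
    F v = step u v (F u) \/ F u = step v u (F v).
Proof.
case=> -[o] conn acG.
have exr u : exists q, [&& path adj o q, uniq (o :: q) & last o q == u].
  have [n [q [pq <- _]]] := conn o u.
  by case: (shortenP pq) => q' pq' uq' _; exists q'; rewrite pq' uq' eqxx.
pose route u := xchoose (exr u).
have routeP u : [/\ path adj o (route u), uniq (o :: route u)
                  & last o (route u) = u].
  by have /and3P[? ? /eqP ?] := xchooseP (exr u).
have route_edge u v : adj u v ->
    route v = rcons (route u) v \/ route u = rcons (route v) u.
  move=> uv; have [pu uu lu] := routeP u; have [pv uv' lv] := routeP v.
  case: (boolP (v \in o :: route u)) => [vu|nvu].
    right; case/splitPl: vu pu uu lu => p1 p2 l1.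
    rewrite cat_path last_cat l1 => /andP[pp1 pp2] uu l2.
    have u1 : uniq (o :: p1) by move: uu; rewrite -cat_cons cat_uniq => /and3P[].
    have -> : route v = p1 by apply: (simple_path_unique acG pv) => //; rewrite lv.
    suff -> : p2 = [:: u] by rewrite cats1.
    apply: (simple_path_unique acG pp2) => //.
    - by rewrite /= adj_sym uv.
    - move: uu; rewrite -cat_cons cat_uniq => /and3P[_ /hasPn H u2].
      rewrite /= u2 andbT; apply/negP => /H /=.
      by rewrite -l1 mem_last.
    rewrite /= andbT inE; apply/eqP => E.
    by move: uv; rewrite E adj_irr.
  left; apply: (simple_path_unique acG pv) => //.
  - by rewrite rcons_path pu lu.
  - by rewrite -rcons_cons rcons_uniq nvu.
  by rewrite lv last_rcons.
pose next (ws : G * S) v := (v, step ws.1 v ws.2).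
pose F u := foldl next (o, s0) (route u).
have F1 u : (F u).1 = u.
  rewrite /F; have [_ _] := routeP u; case/lastP: (route u) => [//|q x].
  by rewrite last_rcons foldl_rcons.
exists (fun u => (F u).2) => u v uv.
by case: (route_edge u v uv) => E; [left|right];
   rewrite {1}/F E foldl_rcons /= -/(F _) F1.
Qed.

(** The colours around w are taken to be the positions in an enumeration of the
neighbours of w, shifted cyclically by a constant depending on w.  Such
colours are distinct around w, and the constant is free to be adjusted so
that the neighbour of w nearer to the root keeps the colour it already has. *)
Lemma tree_colouring (T : sgraph) (D : nat) :
  is_tree T -> max_degree T D -> 0 < D ->
  exists (c : T -> nat) (b : T -> bool),
    [/\ forall u, c u < D,
        forall u v, adj u v -> b v = ~~ b u
      & forall w u v, adj w u -> adj w v -> c u = c v -> u = v].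
Proof.
move=> Ttree [_ degT] D0.
have nbP u : {s : seq T | size s <= D /\ forall v, v \in s <-> adj u v}.
  apply: constructive_indefinite_description.
  by have [d [s [_ sd sP]] dD] := degT u; exists s; rewrite ?sd.
pose nb u := sval (nbP u).
pose idx u v := index v (nb u).
have nbE u v : v \in nb u <-> adj u v := (proj2 (svalP (nbP u))) v.
have idxD u v : adj u v -> idx u v < D.
  move=> /nbE vu; apply: leq_trans (proj1 (svalP (nbP u))).
  by rewrite index_mem.
(* The state at u is its colour (before reduction modulo D), the shift between
   indices in nb u and colours of the neighbours, and the parity. *)
pose step u v (s : nat * nat * bool) :=
  (idx u v + s.1.2, s.1.1 + (D - idx v u), ~~ s.2).
have [F FP] := tree_recursion step (0, 0, false) Ttree.
have colE u v : adj u v -> (F v).1.1 = idx u v + (F u).1.2 %[mod D].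
  move=> uv; case: (FP u v uv) => [-> //|E]; rewrite E /=.
  have := idxD u v uv => H.
  have -> : idx u v + ((F v).1.1 + (D - idx u v)) = (F v).1.1 + D by lia.
  by rewrite modnDr.
exists (fun u => (F u).1.1 %% D), (fun u => (F u).2); split.
- by move=> u; rewrite ltn_mod.
- by move=> u v uv; case: (FP u v uv) => -> //=; rewrite negbK.
move=> w u v wu wv; rewrite (colE _ _ wu) (colE _ _ wv) => /eqP.
rewrite eqn_modDr !modn_small ?idxD // => /eqP E.
have uw : u \in nb w by apply/nbE.
have vw : v \in nb w by apply/nbE.
by rewrite -(nth_index u uw) -(nth_index u vw) -/(idx w u) E.
Qed.

Lemma elegant_labelling (T : sgraph) (h p D : nat) :
  is_tree T -> max_degree T D -> 0 < D -> 0 < p -> p <= h ->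
  exists f : T -> 'I_(h + 2 * (D - 1) * p).+1,
    L_labelling h p p f /\ elegant f.
Proof.
move=> Ttree degT D0 p0 ph; set l := h + _.
have acT : acyclic T by case: Ttree.
have [c [b [cD bN cinj]]] := tree_colouring Ttree degT D0.
pose m := (D - 1) * p.
have lE : l = m + (m + h) by rewrite /l /m -mulnA; lia.
pose F u := c u * p + (if b u then m + h else 0).
have cm u : c u * p <= m by rewrite leq_mul2r; have := cD u; lia.
have Fl u : F u < l.+1 by rewrite /F; have := cm u; case: (b u); lia.
pose f u : 'I_l.+1 := Ordinal (Fl u).
have opp u v : b v = ~~ b u -> h <= `|f u - f v|.
  rewrite /= /F => ->; have := cm u; have := cm v.
  by case: (b u) => /=; lia.
have walk3 u v : dist u v 3 -> b v = ~~ b u.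
  case=> -[] [|x [|y [|z [|t r]]]] [//= /and4P[ux xy yz _] <- _] _.
  by rewrite (bN y z yz) (bN x y xy) (bN u x ux) !negbK.
exists f; split.
  split.
  - by rewrite lE; lia.
  - by move=> u v /dist1P uv; apply: opp; apply: bN.
  - move=> u v /(proj1 (dist2P u v acT)) [nuv [w uw wv]].
    have wu : adj w u by rewrite adj_sym.
    have buv : b u = b v by rewrite (bN _ _ wu) (bN _ _ wv).
    rewrite /= /F buv.
    have nc : c u <> c v by move=> /(cinj w u v wu wv).
    have : c u * p + p <= c v * p \/ c v * p + p <= c u * p.
      rewrite ![_ * p + p]addnC -!mulSn !leq_mul2r; lia.
    by case: (b v); lia.
  by move=> u v /walk3 buv; apply: leq_trans ph (opp _ _ buv).
exists (fun u => if b u then [set x : 'I_l.+1 | x <= m]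
                 else [set x : 'I_l.+1 | m + h <= x]); split.
- move=> u; case: (b u).
    exists 0, m; split=> // x; rewrite inE; split=> [xm|[y ym ->]].
      by exists (x : nat); rewrite ?modn_small.
    by rewrite modn_small; lia.
  exists (m + h), l; split=> [|x]; first by lia.
  have xl := ltn_ord x.
  rewrite inE; split=> [xm|[y ym ->]].
    by exists (x : nat); rewrite ?modn_small //; lia.
  by rewrite modn_small; lia.
- move=> u v uv; have := bN u v uv; have := cm v.
  by case: (b u) => cmv; rewrite inE /= /F => ->; lia.
move=> u v uv; rewrite -setI_eq0 (bN u v uv); apply/eqP/setP => x.
by case: (b u); rewrite !inE /=; lia.
Qed.

(** * The bounds for trees containing a complete ball *)

Lemma is_min_exists (P : nat -> Prop) (n : nat) : P n -> exists m, is_min P m.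
Proof.
elim/ltn_ind: n => n IH Pn.
case: (classic (exists2 k, k < n & P k)) => [[k kn Pk]|no].
  exact: IH kn Pk.
exists n; split=> // k Pk; rewrite leqNgt; apply/negP => kn.
by apply: no; exists k.
Qed.

(** A child of the root has m children and the root as neighbours, m + 1 in all,
while the root itself has only m neighbours: this asymmetry is the loss
of p in the lower bound. *)
Lemma contains_T_neighbours (G : sgraph) (m : nat) : contains_T G m 2 ->
  exists (u : G) (A : seq G),
    [/\ uniq A, size A = m, {in A, forall v, adj u v}
      & {in A, forall v, exists B : seq G,
          [/\ uniq B, size B = m.+1 & {in B, forall w, adj v w}]}].
Proof.
case=> H [o [[Htree _ Hcard Hleaf] [g [ginj gadj]]]].
have notleaf u i : dist o u i -> i < 2 -> has_card (child o u) m.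
  move=> ou i2; apply: Hcard => /Hleaf ou2.
  by rewrite (dist_inj ou ou2) in i2.
have gI : injective g by move=> x y E; apply: ginj E.
have [s [us ss sP]] := notleaf o 0 (dist0 o) isT.
have gE x y : adj x y -> adj (g x) (g y) by apply: gadj.
exists (g o), (map g s); split.
- by rewrite map_inj_uniq.
- by rewrite size_map.
- by move=> _ /mapP[v /sP[ov _] ->]; apply: gE.
move=> _ /mapP[v /sP[ov _] ->].
have dv : dist o v 1 by apply/dist1P.
have [t [ut st tP]] := notleaf v 1 dv isT.
exists (map g (o :: t)); split.
- rewrite map_inj_uniq //= ut andbT; apply/negP => /tP[_ [i [_ oi]]].
  by have := dist_inj oi (dist0 o).
- by rewrite size_map /= st.
move=> _ /mapP[w + ->]; rewrite inE => /orP[/eqP ->|/tP[vw _]]; apply: gE => //.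
by rewrite adj_sym.
Qed.

Lemma contains_That_neighbours (G : sgraph) (m : nat) : contains_That G m 2 ->
  exists (u : G) (A : seq G),
    [/\ uniq A, size A = m.+1, {in A, forall v, adj u v}
      & {in A, forall v, exists B : seq G,
          [/\ uniq B, size B = m.+1 & {in B, forall w, adj v w}]}].
Proof.
case=> R [o [[[_ _ acR] Rdeg] [g [ginj gadj]]]].
have [s [us ss sP]] := Rdeg o.
have ball0 : exists2 i, dist o o i & i <= 2 by exists 0 => //; apply: dist0.
have ball1 v : adj o v -> exists2 i, dist o v i & i <= 2.
  by move=> ov; exists 1 => //; apply/dist1P.
have ball2 v w : adj o v -> adj v w -> exists2 i, dist o w i & i <= 2.
  move=> ov vw; case: (o =P w) => [<- //|now].
  by exists 2 => //; apply/dist2P => //; split=> //; exists v.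
exists (g o), (map g s); split.
- by rewrite map_inj_in_uniq // => x y /sP xo /sP yo; apply: ginj; apply: ball1.
- by rewrite size_map.
- by move=> _ /mapP[v /sP ov ->]; apply: gadj => //; apply: ball1.
move=> _ /mapP[v /sP ov ->].
have [t [ut st tP]] := Rdeg v.
exists (map g t); split.
- by rewrite map_inj_in_uniq // => x y /tP xv /tP yv;
     apply: ginj; apply: (ball2 v).
- by rewrite size_map.
move=> _ /mapP[w /tP vw ->]; apply: gadj => //; first exact: ball1.
exact: (ball2 v).
Qed.

Theorem theorem3p2 (h p D : nat) (T : sgraph)
  (p_ge1 : 1 <= p) (h_gep : p <= h)
  (T_tree : is_tree T)
  (T_size : (finite_graph T /\ exists2 d, diameter T d & 3 <= d)
            \/ infinite_graph T)
  (T_maxdeg : max_degree T D)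
  (D_ge3 : 3 <= D) :
  (contains_T T (D - 1) 2 ->
     exists l ls : nat,
       [/\ lambda T h p p l,
           lambda_star T h p p ls,
           h + (2 * D - 3) * p <= l,
           l <= ls
         & ls <= h + 2 * (D - 1) * p])
  /\
  (contains_That T (D - 1) 2 ->
     lambda T h p p (h + 2 * (D - 1) * p)
     /\ lambda_star T h p p (h + 2 * (D - 1) * p)).
Proof.
have acT : acyclic T by case: T_tree.
have D0 : 0 < D by lia.
have [f [fL fE]] := elegant_labelling T_tree T_maxdeg D0 p_ge1 h_gep.
have DE : (D - 1).+1 = D by lia.
split=> [/contains_T_neighbours|/contains_That_neighbours];
  rewrite DE => -[u [A [uA sA adjA nbA]]].
  have lower l (g : T -> 'I_l.+1) : L_labelling h p p g ->
      h + (2 * D - 3) * p <= l.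
    move=> gL; have D1 : 0 < D - 1 by lia.
    have := span_lower_bound acT p_ge1 h_gep gL D1 uA sA adjA nbA.
    have -> : (D - 1 + D).-1 = (2 * D - 3).+1 by lia.
    by rewrite mulSn; lia.
  have [ls lsP] := is_min_exists (P := fun l => exists f : T -> 'I_l.+1,
    L_labelling h p p f /\ elegant f) (ex_intro _ f (conj fL fE)).
  have [l lP] := is_min_exists (P := fun l => exists f : T -> 'I_l.+1,
    L_labelling h p p f) (ex_intro _ f fL).
  exists l, ls; split=> //.
  - by case: lP => -[g gL] _; apply: lower gL.
  - by case: lsP => -[g [gL _]] _; apply: (proj2 lP); exists g.
  - by apply: (proj2 lsP); exists f.
have lower l (g : T -> 'I_l.+1) : L_labelling h p p g ->
    h + 2 * (D - 1) * p <= l.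
  move=> gL; have := span_lower_bound acT p_ge1 h_gep gL D0 uA sA adjA nbA.
  have -> : (D + D).-1 = (2 * (D - 1)).+1 by lia.
  by rewrite mulSn; lia.
split; split.
- by exists f.
- by move=> l [g gL]; apply: lower gL.
- by exists f.
- by move=> l [g [gL _]]; apply: lower gL.
Qed.
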